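(* Let $\Sigma$ be a complete fan in $\mathbb{R}^n$, $\phi$ a strictly concave rational PL function on $\Sigma$, and $r\in\mathbb{N}^+$ such that $r\phi$ is integral. For any $\rho\in\Sigma(1)$ one has $$\lim_{a\to 0^+}w_{\rho,r\phi}(a)=2\pi\, r\phi(u_\rho).$$
   Context: Let $n\ge 1$. A complete fan $\Sigma$ in $\mathbb{R}^n$ is a finite collection of strongly convex rational polyhedral cones, closed under taking faces and intersections (two cones meet along a common face), whose union is $\mathbb{R}^n$. $\Sigma(k)$ is the set of $k$-dimensional cones; for a ray $\rho\in\Sigma(1)$, $u_\rho\in\mathbb{Z}^n$ is its primitive generator. A PL function on $\Sigma$ is a continuous $\phi:\mathbb{R}^n\to\mathbb{R}$ linear on each cone; for $\sigma\in\Sigma(n)$ write $\phi|_\sigma=\langle m_\sigma,\cdot\rangle$. It is rational (resp. integral) if all $m_\sigma\in\mathbb{Q}^n$ (resp. $\mathbb{Z}^n$). It is strictly concave if $\phi(x)=\min_{\sigma\in\Sigma(n)}\langle m_\sigma,x\rangle$ for all $x$ and, for every $\sigma\in\Sigma(n)$, $\phi(x)=\langle m_\sigma,x\rangle$ if and only if $x\in\sigma$. Set $P_{r\phi}=\{m\in\mathbb{R}^n:\langle m,u_\rho\rangle\ge r\phi(u_\rho)\ \forall\rho\in\Sigma(1)\}$. For $m\in\mathbb{Z}^n$ let $\chi^m(z)=z_1^{m^{(1)}}\cdots z_n^{m^{(n)}}$ on $(\mathbb{C}^\times)^n$, and $$\theta_{r\phi}=-\frac{i}{2}\sum_{k=1}^n\frac{\sum_{m\in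 P_{r\phi}\cap\mathbb{Z}^n}m^{(k)}|\chi^m|^2}{\sum_{m\in P_{r\phi}\cap\mathbb{Z}^n}|\chi^m|^2}\left(\frac{dz_k}{z_k}-\frac{d\overline{z}_k}{\overline{z}_k}\right).$$ Let $\lambda_{u_\rho}:\mathbb{C}^\times\to(\mathbb{C}^\times)^n$, $\lambda_{u_\rho}(t)=(t^{u_\rho^{(1)}},\dots,t^{u_\rho^{(n)}})$. The wrapping function is $w_{\rho,r\phi}:(0,\infty)\to\mathbb{R}$, $w_{\rho,r\phi}(a)=\int_{|t|=a}\lambda_{u_\rho}^*\theta_{r\phi}$ (circle oriented counterclockwise). *)

(* Defs.v *)
From HB Require Import structures.
From mathcomp Require Import all_boot all_order all_algebra.
From mathcomp Require Import complex.
From mathcomp Require Import all_classical all_reals all_analysis.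

Set Implicit Arguments.
Unset Strict Implicit.
Unset Printing Implicit Defensive.

Import Order.TTheory GRing.Theory Num.Theory.
Import numFieldNormedType.Exports.

Local Open Scope classical_set_scope.
Local Open Scope ring_scope.
Local Open Scope complex_scope.

Section Fans.
Variables (R : realType) (n : nat).
Implicit Types (m x : 'rV[R]_n) (u : 'rV[int]_n) (sigma tau rho : set 'rV[R]_n).
Implicit Types (Sigma : set (set 'rV[R]_n)) (phi psi : 'rV[R]_n -> R).

Definition pairing m x : R := \sum_(k < n) m 0 k * x 0 k.

Definition of_lattice u : 'rV[R]_n := map_mx intr u.

Definition cone_hull (s : seq 'rV[R]_n) : set 'rV[R]_n :=
  [set \sum_(i < size s) c i *: s`_i | c in [set c | forall i, 0 <= c i]].

Definition rational_polyhedral_cone sigma :=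
  exists s : seq 'rV[int]_n, sigma = cone_hull (map of_lattice s).

Definition strongly_convex sigma :=
  forall x, sigma x -> sigma (- x) -> x = 0.

(* [m = 0] is allowed, so a cone is a face of itself. *)
Definition face tau sigma :=
  exists m, (forall x, sigma x -> 0 <= pairing m x) /\
    tau = sigma `&` [set x | pairing m x = 0].

Record complete_fan Sigma : Prop := CompleteFan {
  fan_finite : finite_set Sigma ;
  fan_cone : forall sigma, Sigma sigma ->
    rational_polyhedral_cone sigma /\ strongly_convex sigma ;
  fan_face : forall sigma tau, Sigma sigma -> face tau sigma -> Sigma tau ;
  fan_meet : forall sigma tau, Sigma sigma -> Sigma tau ->
    face (sigma `&` tau) sigma /\ face (sigma `&` tau) tau ;
  fan_complete : \bigcup_(sigma in Sigma) sigma = setT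
}.

(* The dimension of a cone is that of its linear span, i.e. of the smallest
   subspace containing it. *)
Definition cone_dim sigma (d : nat) :=
  exists U : {vspace 'rV[R]_n},
    [/\ forall x, sigma x -> x \in U,
        forall W : {vspace 'rV[R]_n},
          (forall x, sigma x -> x \in W) -> (U <= W)%VS
      & \dim U = d].

Definition cones Sigma (d : nat) : set (set 'rV[R]_n) :=
  [set sigma | Sigma sigma /\ cone_dim sigma d].

(* Coordinates with gcd 1; in particular [u != 0]. *)
Definition primitive u := \big[gcdz/0]_(k < n) u 0 k = 1.

Definition ray_gen rho : 'rV[int]_n :=
  xget 0 [set u | rho (of_lattice u) /\ primitive u].

Definition pl_function Sigma phi :=
  continuous phi /\
  forall sigma, Sigma sigma ->
    exists m, forall x, sigma x -> phi x = pairing m x.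

(* The vector m_sigma, unique when [sigma] is full-dimensional. *)
Definition slope phi sigma : 'rV[R]_n :=
  xget 0 [set m | forall x, sigma x -> phi x = pairing m x].

Definition rational_pl Sigma phi := pl_function Sigma phi /\
  forall sigma, cones Sigma n sigma ->
    exists q : 'rV[rat]_n, slope phi sigma = map_mx ratr q.

Definition integral_pl Sigma phi := pl_function Sigma phi /\
  forall sigma, cones Sigma n sigma ->
    exists u, slope phi sigma = of_lattice u.

Definition strictly_concave Sigma phi :=
  (forall x,
     (forall sigma, cones Sigma n sigma ->
        phi x <= pairing (slope phi sigma) x) /\
     (exists2 sigma, cones Sigma n sigma &
        phi x = pairing (slope phi sigma) x)) /\
  (forall sigma, cones Sigma n sigma ->
     forall x, phi x = pairing (slope phi sigma) x <-> sigma x).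

Definition polytope Sigma psi : set 'rV[R]_n :=
  [set m | forall rho, cones Sigma 1 rho ->
     psi (of_lattice (ray_gen rho)) <= pairing m (of_lattice (ray_gen rho))].

Definition lattice_points Sigma psi : set 'rV[int]_n :=
  [set u | polytope Sigma psi (of_lattice u)].

End Fans.

(* A complex-valued 1-form on (an open subset of) a complex vector space V is
   given by its value [omega z v] at the base point z on the tangent vector v,
   R-linear in v. *)
Definition one_form (R : realType) (V : Type) := V -> V -> R[i].

Section Forms.
Variables (R : realType) (n : nat).
Let C := (R[i] : numClosedFieldType).
Implicit Types (u : 'rV[int]_n) (z v : 'rV[C]_n) (t : C).

Definition chi u z : C := \prod_(k < n) z 0 k ^ u 0 k.

(* The sums over the lattice points of the polytope are finite, the polytope of
   a complete fan being bounded; [dz_k] and its conjugate send the tangent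
   vector [v] to [v 0 k] and to the conjugate of [v 0 k]. *)
Definition theta (Sigma : set (set 'rV[R]_n)) (psi : 'rV[R]_n -> R) :
    one_form R 'rV[C]_n := fun z v =>
  - ('i%C / 2) * \sum_(k < n)
    ((\sum_(u \in lattice_points Sigma psi) ((u 0 k)%:~R * `|chi u z| ^+ 2)) /
     (\sum_(u \in lattice_points Sigma psi) `|chi u z| ^+ 2)) *
    (v 0 k / z 0 k - (v 0 k)^* / (z 0 k)^*).

Definition one_param u t : 'rV[C]_n := \row_(k < n) t ^ u 0 k.

(* Pullback along a holomorphic map: the differential ['d f t] is taken over
   the complex scalars. *)
Definition pullback (f : C -> 'rV[C]_n) (omega : one_form R 'rV[C]_n) :
    one_form R C := fun t h => omega (f t) ('d f t h).

End Forms.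

Section Wrapping.
Variable R : realType.
Let C := (R[i] : numClosedFieldType).

Definition integralC (D : set R) (g : R -> C) : C :=
  (\int[lebesgue_measure]_(s in D) complex.Re (g s)) +i*
  (\int[lebesgue_measure]_(s in D) complex.Im (g s)).

Definition velocity (gamma : R -> C) (s : R) : C :=
  derive1 (fun x => complex.Re (gamma x)) s +i*
  derive1 (fun x => complex.Im (gamma x)) s.

Definition circle (a s : R) : C := (a * cos s) +i* (a * sin s).

Definition circle_integral (a : R) (omega : one_form R C) : C :=
  integralC `[0, 2 * pi]%classic
    (fun s => omega (circle a s) (velocity (circle a) s)).

(* The values are real numbers, seen in C; only [0 < a] is meaningful. *)
Definition wrapping (n : nat) (Sigma : set (set 'rV[R]_n))
    (rho : set 'rV[R]_n) (psi : 'rV[R]_n -> R) (a : R) : C :=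
  circle_integral a (pullback (@one_param R n (ray_gen rho)) (theta Sigma psi)).

End Wrapping.

(* Main.v *)
(* On the circle |t| = a, the pullback of theta along the one-parameter subgroup
   of u = u_rho is dt/(it) times the average of <m, u> over the lattice points m
   of P_{r phi}, with weights a^{2 <m, u>}.  The wrapping function is therefore
   2 pi times this average, which tends as a -> 0 to the minimum of <m, u> over
   the lattice points.  That minimum is r phi(u): it is a lower bound by
   definition of P_{r phi}, and it is attained at r m_sigma, where sigma is a
   maximal cone on which m_sigma computes phi(u).
   The average makes sense because P_{r phi} is bounded: each cone of the fan is
   generated by its rays, so m in P_{r phi} forces <m, x> >= r phi(x) for all x,
   and in particular for the vectors +-e_k. *)
Require Import Defs.
From mathcomp Require Import all_boot all_order all_algebra.
From mathcomp Require Import complex ring.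
From mathcomp Require Import all_classical all_reals all_analysis.

Set Implicit Arguments.
Unset Strict Implicit.
Unset Printing Implicit Defensive.

Import Order.TTheory GRing.Theory Num.Theory.
Import numFieldNormedType.Exports.

Local Open Scope classical_set_scope.
Local Open Scope ring_scope.

(** * Polyhedral cones *)

Section Pairing.
Variables (R : realType) (n : nat).
Implicit Types (m x y : 'rV[R]_n).

Lemma pairingE m x : pairing m x = (m *m x^T) 0 0.
Proof. by rewrite mxE; apply: eq_bigr => k _; rewrite mxE. Qed.

Lemma pairingC m x : pairing m x = pairing x m.
Proof. by apply: eq_bigr => k _; rewrite mulrC. Qed.

Lemma pairingDl m1 m2 x : pairing (m1 + m2) x = pairing m1 x + pairing m2 x.
Proof. by rewrite !pairingE mulmxDl mxE. Qed.

Lemma pairingZl c m x : pairing (c *: m) x = c * pairing m x.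
Proof. by rewrite !pairingE -scalemxAl mxE. Qed.

Lemma pairingNl m x : pairing (- m) x = - pairing m x.
Proof. by rewrite -scaleN1r pairingZl mulN1r. Qed.

Lemma pairingDr m x y : pairing m (x + y) = pairing m x + pairing m y.
Proof. by rewrite pairingC pairingDl !(pairingC m). Qed.

Lemma pairingZr c m x : pairing m (c *: x) = c * pairing m x.
Proof. by rewrite pairingC pairingZl pairingC. Qed.

Lemma pairingNr m x : pairing m (- x) = - pairing m x.
Proof. by rewrite pairingC pairingNl pairingC. Qed.

Lemma pairing0l x : pairing 0 x = 0.
Proof. by rewrite -(scale0r 0) pairingZl mul0r. Qed.

Lemma pairing0r m : pairing m 0 = 0.
Proof. by rewrite pairingC pairing0l. Qed.

Lemma pairing_delta m k : pairing m (delta_mx 0 k) = m 0 k.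
Proof.
rewrite /pairing (bigD1 k)//= big1 => [|j /negPf jk].
  by rewrite mxE !eqxx mulr1 addr0.
by rewrite mxE jk andbF mulr0.
Qed.

Lemma pairing_ge0 x : 0 <= pairing x x.
Proof. by apply: sumr_ge0 => k _; rewrite -expr2 sqr_ge0. Qed.

Lemma pairing_gt0 x : x != 0 -> 0 < pairing x x.
Proof.
move=> x0; rewrite lt_def pairing_ge0 andbT; apply: contraNneq x0 => /eqP.
rewrite psumr_eq0 => [/allP xx0|k _]; last by rewrite -expr2 sqr_ge0.
apply/eqP/rowP => k; rewrite mxE; apply/eqP.
by have := xx0 k (mem_index_enum _); rewrite -expr2 sqrf_eq0.
Qed.

Lemma pairing_injr x y : (forall m, pairing m x = pairing m y) -> x = y.
Proof.
by move=> xy; apply/rowP => k; rewrite -!pairing_delta pairingC xy pairingC.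
Qed.

End Pairing.

(** * Finitely generated cones: faces, separation, strong convexity *)

Section ConeHull.
Variables (R : realType) (n : nat).
Implicit Types (m x y : 'rV[R]_n) (s : seq 'rV[R]_n).

Lemma cone_hull_nil x : cone_hull [::] x <-> x = 0.
Proof.
split=> [[c _ <-]|->]; first by rewrite big_ord0.
by exists (fun=> 0) => //=; rewrite big_ord0.
Qed.

Lemma cone_hull_cons a s x :
  cone_hull (a :: s) x <->
  exists2 c, 0 <= c & exists2 y, cone_hull s y & x = c *: a + y.
Proof.
split=> [[c c0 <-]|[c c0 [_ [d d0 <-] ->]]].
  exists (c ord0); first exact: c0.
  exists (\sum_(i < size s) c (lift ord0 i) *: s`_i) => //.
    by exists (fun i => c (lift ord0 i)) => // i; exact: c0.
  by rewrite /= big_ord_recl.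
exists (fun i => oapp d c (unlift ord0 i)).
  by move=> i; case: unliftP => [j|] _ //=; exact: d0.
rewrite /= big_ord_recl unlift_none/=; congr (_ + _).
by apply: eq_bigr => i _; rewrite liftK.
Qed.

Lemma cone_hull0 s : cone_hull s 0.
Proof. by exists (fun=> 0) => //; apply: big1 => i _; rewrite scale0r. Qed.

Lemma cone_hull_mem s x : x \in s -> cone_hull s x.
Proof.
elim: s => // a s IH; rewrite inE => /predU1P[->|xs]; apply/cone_hull_cons.
  by exists 1 => //; exists 0; [exact: cone_hull0|rewrite scale1r addr0].
by exists 0 => //; exists x; [exact: IH|rewrite scale0r add0r].
Qed.

Lemma cone_hull_scale s c x : 0 <= c -> cone_hull s x -> cone_hull s (c *: x).
Proof.
move=> c0 [d d0 <-]; exists (fun i => c * d i).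
  by move=> i; rewrite mulr_ge0.
by rewrite scaler_sumr; apply: eq_bigr => i _; rewrite scalerA.
Qed.

Lemma cone_hull_ind s (P : 'rV[R]_n -> Prop) : P 0 ->
  (forall c a y, 0 <= c -> a \in s -> P y -> P (c *: a + y)) ->
  forall x, cone_hull s x -> P x.
Proof.
move=> P0; elim: s => [_ x /cone_hull_nil ->//|a s IH] PS x.
move=> /cone_hull_cons[c c0 [y sy ->]]; apply: (PS) => //.
  exact: mem_head.
by apply: IH sy => d b z d0 bs; apply: PS; rewrite // inE bs orbT.
Qed.

Lemma cone_hull_pairing_ge0 s m x :
  {in s, forall a, 0 <= pairing m a} -> cone_hull s x -> 0 <= pairing m x.
Proof.
move=> ms; elim/cone_hull_ind => [|c a y c0 /ms ma my].
  by rewrite pairing0r.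
by rewrite pairingDr pairingZr addr_ge0// mulr_ge0.
Qed.

(** A sum of nonnegative terms vanishes only if each term does, so generators at which [m] is
    positive get coefficient 0. A face is thus generated by a sublist, which permits induction on
    the number of generators. *)
Lemma cone_hull_face s m : {in s, forall a, 0 <= pairing m a} ->
  cone_hull s `&` [set x | pairing m x = 0] =
  cone_hull [seq a <- s | pairing m a == 0].
Proof.
elim: s => [_|a s IH ms].
  apply/seteqP; split=> [x []//|x sx]; split=> //.
  by have /cone_hull_nil -> := sx; exact: pairing0r.
have {}IH : cone_hull s `&` [set x | pairing m x = 0] =
    cone_hull [seq a <- s | pairing m a == 0].
  by apply: IH => b bs; apply: ms; rewrite inE bs orbT.
have ma0 : 0 <= pairing m a by rewrite ms ?mem_head.
have ms0 y : cone_hull s y -> 0 <= pairing m y.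
  by apply: cone_hull_pairing_ge0 => b bs; apply: ms; rewrite inE bs orbT.
apply/seteqP; split=> x /=.
  move=> [/cone_hull_cons[c c0 [y sy ->]] /eqP].
  rewrite pairingDr pairingZr paddr_eq0 ?(mulr_ge0 c0 ma0) ?(ms0 y)// mulf_eq0.
  move=> /andP[ca /eqP my0].
  have y' : cone_hull [seq a <- s | pairing m a == 0] y by rewrite -IH.
  case: ifPn ca => [_ _|_].
    by apply/cone_hull_cons; exists c => //; exists y.
  by rewrite orbF => /eqP ->; rewrite scale0r add0r.
case: ifPn => [/eqP ma|_].
  move=> /cone_hull_cons[c c0 [y]]; rewrite -IH => -[sy my] ->; split.
    by apply/cone_hull_cons; exists c => //; exists y.
  by rewrite pairingDr pairingZr ma mulr0 my addr0.
rewrite -IH => -[sx mx]; split=> //.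
by apply/cone_hull_cons; exists 0 => //; exists x => //; rewrite scale0r add0r.
Qed.

(* Bartl's induction on the number of generators: a functional [m] that fails
   only at the new generator [a] is corrected by projecting onto [ker m] along
   [a]. *)
Lemma farkas s x : ~ cone_hull s x ->
  exists2 m, {in s, forall a, 0 <= pairing m a} & pairing m x < 0.
Proof.
have [k] := ubnP (size s); elim: k s x => // k IH [x _ sx|a s x sk sx].
  exists (- x) => //; rewrite pairingNl oppr_lt0 pairing_gt0//.
  by apply: contra_notN sx => /eqP/cone_hull_nil.
have [//||m ms mx] := IH s x.
  move=> sx'; apply: sx; apply/cone_hull_cons; exists 0 => //.
  by exists x => //; rewrite scale0r add0r.
have [ma|ma] := leP 0 (pairing m a).
  by exists m => // b; rewrite inE => /predU1P[->//|/ms].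
have ma0 : pairing m a != 0 by rewrite lt_eqF.
pose proj y := y - (pairing m y / pairing m a) *: a.
have [||m' m's m'x] := IH (map proj s) (proj x).
- by rewrite size_map.
- move=> px.
  (* Each [proj b] is [b] plus a multiple of [a], nonnegative because [m] is nonnegative at [b] and
     negative at [a]. *)
  have {px} [c c0 [y sy pxE]] : exists2 c, 0 <= c &
      exists2 y, cone_hull s y & proj x = c *: a + y.
    elim: (s) ms (proj x) px => [_ y /cone_hull_nil ->|b t IHt mt y].
      by exists 0 => //; exists 0; [exact: cone_hull0|rewrite scale0r addr0].
    move=> /cone_hull_cons[c c0 [z tz ->]].
    have [|d d0 [w tw ->]] := IHt _ z tz.
      by move=> e et; apply: mt; rewrite inE et orbT.
    exists (c * (pairing m b / - pairing m a) + d).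
      rewrite addr_ge0// mulr_ge0// divr_ge0 ?mt ?mem_head//.
      by rewrite oppr_ge0 ltW.
    exists (c *: b + w).
      by apply/cone_hull_cons; exists c => //; exists w.
    by apply/rowP => k'; rewrite /proj !mxE; field.
  (* [x] is [proj x] plus [pairing m x / pairing m a] times [a], and this coefficient is a quotient
     of two negative numbers. *)
  apply: sx; apply/cone_hull_cons; exists (c + pairing m x / pairing m a).
    by rewrite addr_ge0// ltW// nmulr_rgt0// invr_lt0.
  by exists y => //; rewrite scalerDl addrAC -pxE /proj subrK.
(* [m''] is [m'] composed with [proj], so it vanishes at [a]. *)
- pose m'' := m' - (pairing m' a / pairing m a) *: m.
  have m''E y : pairing m'' y = pairing m' (proj y).
    rewrite /m'' /proj pairingDl pairingDr pairingNl pairingNr.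
    by rewrite pairingZl pairingZr mulrAC -mulrA mulrC mulrAC.
  exists m''; last by rewrite m''E.
  move=> b; rewrite inE => /predU1P[->|bs]; last first.
    by rewrite m''E m's// map_f.
  by rewrite m''E /proj divff// scale1r subrr pairing0r.
Qed.

(** For each generator [a != 0], strong convexity puts [- a] outside the cone; [farkas] separates
    it, and the sum of the separating functionals works. *)
Lemma strongly_convex_pos s : strongly_convex (cone_hull s) ->
  exists p, {in s, forall a, a != 0 -> 0 < pairing p a}.
Proof.
move=> sc.
suff [p [_ pp]] : exists p, {in s, forall a, 0 <= pairing p a} /\
    {in s, forall a, a != 0 -> 0 < pairing p a} by exists p.
have : {subset s <= s} by [].
(* Strict positivity is acquired along the sublist [t]; nonnegativity is kept on all of [s]. *)
elim: {1 4}s => [_|a t IH tS].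
  by exists 0; split=> // a _; rewrite pairing0l.
have [|p [ps pt]] := IH; first by move=> b bt; rewrite tS// inE bt orbT.
have as_ : a \in s by rewrite tS// mem_head.
have [a0|a0] := eqVneq a 0.
  by exists p; split=> // b; rewrite inE => /predU1P[->|/pt//]; rewrite a0 eqxx.
have [|m ms] := @farkas s (- a).
  by move=> sNa; move/eqP: a0; apply; apply: sc => //; exact: cone_hull_mem.
rewrite pairingNr oppr_lt0 => ma; exists (m + p); split=> [b bs|b].
  by rewrite pairingDl addr_ge0 ?ms ?ps.
rewrite inE pairingDl => /predU1P[-> _|bt b0].
  by rewrite ltr_pwDl ?ps.
by rewrite ltr_wpDl ?pt ?ms// tS// inE bt orbT.
Qed.

End ConeHull.

(** * Rays of a complete fan *)

Section Primitive.
Variable n : nat.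
Implicit Types u : 'rV[int]_n.

Lemma primitive_neq0 u : primitive u -> u != 0.
Proof.
apply: contraPneq => ->; rewrite /primitive.
suff -> : \big[gcdz/0]_(k < n) (0 : 'rV[int]_n) 0 k = 0 by [].
apply: (big_ind (fun z : int => z = 0)) => [//|x y -> -> //|k _].
by rewrite mxE.
Qed.

Lemma primitive_part u : u != 0 ->
  exists2 g : int, 0 < g & exists2 v, primitive v & u = g *: v.
Proof.
move=> u0; pose g := \big[gcdz/0]_(k < n) u 0 k.
have g_dvd k : (g %| u 0%R k)%Z.
  rewrite /g; elim: (index_enum _) (mem_index_enum k) => // j r IH.
  rewrite inE big_cons => /predU1P[->|/IH]; first exact: dvdz_gcdl.
  by apply: dvdz_trans; exact: dvdz_gcdr.
have g_ge0 : 0 <= g.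
  by rewrite /g; elim/big_rec : _.
have g0 : g != 0.
  apply: contra_neq u0 => g0; apply/rowP => k; rewrite mxE.
  by have := g_dvd k; rewrite g0 dvd0z => /eqP.
exists g; first by rewrite lt_def g0.
pose v := \row_k (u 0%R k %/ g)%Z.
have uE : u = g *: v by apply/rowP => k; rewrite !mxE mulrC divzK.
exists v => //.
have : g = g * \big[gcdz/0]_(k < n) v 0 k.
  rewrite {1}/g uE; elim/big_rec2 : _ => [|k x y _ ->]; first by rewrite mulr0.
  by rewrite [(g *: v) _ _]mxE -mulz_gcdr gez0_abs.
move=> /esym/eqP; rewrite -subr_eq0 -{2}(mulr1 g) -mulrBr mulf_eq0.
by rewrite (negPf g0)/= subr_eq0 => /eqP.
Qed.

End Primitive.

Section FanRays.
Variables (R : realType) (n : nat).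
Implicit Types (m x p q l : 'rV[R]_n) (s : seq 'rV[int]_n).
Implicit Types (Sigma : set (set 'rV[R]_n)) (sigma rho : set 'rV[R]_n).

Lemma of_lattice_eq0 (u : 'rV[int]_n) : (of_lattice R u == 0) = (u == 0).
Proof.
apply/eqP/eqP => [u0|->]; last by apply/rowP => k; rewrite !mxE.
apply/rowP => k; move/rowP: u0 => /(_ k); rewrite !mxE => /eqP.
by rewrite intr_eq0 => /eqP.
Qed.

(** [c] is the least ratio of [q] to [p] over the nonzero generators; [a] provides the starting
    index for the minimum. *)
Lemma ratio_min (S : seq 'rV[R]_n) p q a :
  {in S, forall b, b != 0 -> 0 < pairing p b} -> a \in S -> a != 0 ->
  exists c, {in S, forall b, 0 <= pairing (q - c *: p) b} /\
    exists2 b, b \in S & b != 0 /\ pairing (q - c *: p) b = 0.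
Proof.
move=> pS aS a0.
have Sa : S`_(index a S) = a by rewrite nth_index.
pose i0 := Ordinal (etrans (index_mem a S) aS : index a S < size S)%N.
have : S`_i0 != 0 by rewrite Sa.
move=> /(@arg_minP _ _ _ i0 (fun i => S`_i != 0)
  (fun i => pairing q S`_i / pairing p S`_i)).
set i := [arg min_(_ < _ | _) _]%O; case=> j j0 jmin.
exists (pairing q S`_j / pairing p S`_j); split => [b bS|].
  rewrite pairingDl pairingNl pairingZl.
  have [->|b0] := eqVneq b 0; first by rewrite !pairing0r mulr0 subr0.
  rewrite subr_ge0 -ler_pdivlMr ?pS//.
  have bi : (index b S < size S)%N by rewrite index_mem.
  by have := jmin (Ordinal bi); rewrite /= nth_index//; exact.
exists S`_j; first exact: mem_nth.
split=> //; rewrite pairingDl pairingNl pairingZl divfK ?subrr//.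
by rewrite gt_eqF// pS// mem_nth.
Qed.

Lemma cone_hull_ray (S : seq 'rV[R]_n) a x :
  {in S, forall b, exists2 t, 0 <= t & b = t *: a} -> cone_hull S x ->
  exists2 t, 0 <= t & x = t *: a.
Proof.
move=> Sa; elim/cone_hull_ind => [|c b y c0 /Sa[t t0 ->] [d d0 ->]].
  by exists 0; rewrite ?scale0r.
by exists (c * t + d); rewrite ?scalerDl ?scalerA// addr_ge0// mulr_ge0.
Qed.

(* Let [p] be positive on the cone minus the origin.  For a functional [q], the
   minimum [c] of [q / p] over the generators cuts out the nonzero face
   [q = c p].  With [q = l], descend to this face, where [l = c p < 0].  If it is
   the whole cone, [l] is negative on every nonzero face, so one can descend to
   the face of any [q] not proportional to [p]; if there is none, the cone is a
   ray. *)
Lemma fan_ray_neg Sigma l s : complete_fan Sigma ->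
  Sigma (cone_hull (map (@of_lattice R n) s)) ->
  has (fun a => pairing l (of_lattice R a) < 0) s ->
  exists2 rho, cones Sigma 1 rho &
    cone_hull (map (@of_lattice R n) s) (of_lattice R (ray_gen rho)) /\
    pairing l (of_lattice R (ray_gen rho)) < 0.
Proof.
move=> fan; have [k] := ubnP (size s); elim: k s => // k IH s sk sS ls.
pose S := map (@of_lattice R n) s.
have [p pS] : exists p, {in S, forall b, b != 0 -> 0 < pairing p b}.
  by apply: strongly_convex_pos; have [] := fan_cone fan sS.
(* Induction step: the first witness keeps [l] negative somewhere on the face; the second is a
   generator off the face, so the list gets shorter. *)
have proper_face m : {in S, forall b, 0 <= pairing m b} ->
    (exists2 b, b \in S & pairing m b = 0 /\ pairing l b < 0) ->
    (exists2 b, b \in S & pairing m b != 0) ->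
    exists2 rho, cones Sigma 1 rho &
      cone_hull S (of_lattice R (ray_gen rho)) /\
      pairing l (of_lattice R (ray_gen rho)) < 0.
  move=> mS [_ /mapP[b bs ->] [mb lb]] [_ /mapP[d ds ->] md].
  pose s' := [seq a <- s | pairing m (of_lattice R a) == 0].
  have tE : cone_hull S `&` [set x | pairing m x = 0] =
      cone_hull (map (@of_lattice R n) s').
    by rewrite cone_hull_face// /s' filter_map.
  have [|||rho rho1 [rhot lrho]] := IH s'.
  - rewrite -ltnS; apply: leq_trans sk; rewrite !ltnS size_filter.
    rewrite -(count_predC (fun a => pairing m (of_lattice R a) == 0) s).
    by rewrite -addn1 leq_add2l -has_count; apply/hasP; exists d.
  - rewrite -tE; apply: (fan_face fan sS); exists m; split => // x.
    exact: cone_hull_pairing_ge0.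
  - by apply/hasP; exists b => //; rewrite mem_filter mb eqxx.
  - by exists rho => //; split=> //; move: rhot; rewrite -tE => -[].
have {ls} [a aS la] : exists2 a, a \in S & pairing l a < 0.
  by move/hasP: ls => [a sa la]; exists (of_lattice R a) => //; exact: map_f.
have nz b : pairing l b < 0 -> b != 0.
  by apply: contraTneq => ->; rewrite pairing0r ltxx.
have a0 := nz _ la.
have [c [lc [b bS [b0 lb]]]] := ratio_min l pS aS a0.
have c0 : c < 0.
  have := lc _ aS; rewrite pairingDl pairingNl pairingZl subr_ge0 => ca.
  by have := le_lt_trans ca la; rewrite pmulr_llt0// pS.
have lt0 d : d \in S -> d != 0 -> pairing (l - c *: p) d = 0 -> pairing l d < 0.
  move=> dS d0; rewrite pairingDl pairingNl pairingZl => /eqP.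
  by rewrite subr_eq0 => /eqP ->; rewrite pmulr_llt0// pS.
have [/hasP[d dS ld]|/hasPn lS] :=
    boolP (has (fun d => pairing (l - c *: p) d != 0) S).
  apply: (proper_face (l - c *: p)) => //; last by exists d.
  by exists b => //; split=> //; exact: lt0.
have {}lS d : d \in S -> d != 0 -> pairing l d < 0.
  by move=> dS d0; apply: lt0 => //; move: (lS _ dS); rewrite negbK => /eqP.
have [[q [d dS qd]]|prop] := pselect (exists q, exists2 d, d \in S &
    pairing q d * pairing p a != pairing q a * pairing p d).
  have [e [qe [f fS [f0 qf]]]] := ratio_min q pS aS a0.
  apply: (proper_face (q - e *: p)) => //.
    by exists f => //; split=> //; exact: lS.
  (* If the face contained both [a] and [d], then [q] would equal [e *: p] at both and the cross
     products in [qd] would agree. *)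
  have [qa|qa] := eqVneq (pairing (q - e *: p) a) 0; last by exists a.
  exists d => //; apply: contra_neq qd => qd.
  move: qa qd; rewrite !pairingDl !pairingNl !pairingZl.
  move=> /eqP; rewrite subr_eq0 => /eqP -> /eqP; rewrite subr_eq0 => /eqP ->.
  by rewrite mulrAC.
have pa0 : 0 < pairing p a by exact: pS.
(* The coefficient is read off from [p]; the equality of vectors is tested against every functional
   [q]. *)
have Sa d : d \in S -> exists2 t, 0 <= t & d = t *: a.
  move=> dS; exists (pairing p d / pairing p a).
    rewrite divr_ge0 ?(ltW pa0)//.
    by have [->|/(pS _ dS)/ltW//] := eqVneq d 0; rewrite pairing0r.
  apply: pairing_injr => q; rewrite pairingZr mulrAC.
  apply: (canRL (mulfK _)); first by rewrite gt_eqF.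
  rewrite [RHS]mulrC.
  by apply/eqP/negPn/negP => qd; apply: prop; exists q, d.
have Sa' x : cone_hull S x -> exists2 t, 0 <= t & x = t *: a.
  exact: cone_hull_ray.
exists (cone_hull S).
  split=> //; exists <[a]>%VS; split.
  - by move=> x /Sa'[t _ ->]; rewrite memvZ// memv_line.
  - by move=> W SW; rewrite -memvE; apply: SW; exact: cone_hull_mem.
  - by rewrite dim_vline a0.
(* [ray_gen] is a choice with default 0, so a primitive lattice vector has to be exhibited: the
   primitive part of the integral generator behind [a]. *)
have [Srg /primitive_neq0 rg0] :
    cone_hull S (of_lattice R (ray_gen (cone_hull S))) /\
    primitive (ray_gen (cone_hull S)).
  have /mapP[a' _ aE] := aS.
  have [g g0 [v vprim a'E]] : exists2 g : int, 0 < g &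
      exists2 v, primitive v & a' = g *: v.
    by apply: primitive_part; rewrite -of_lattice_eq0 -aE.
  apply: (@xgetPex _ 0 [set u | cone_hull S (of_lattice R u) /\ primitive u]).
  exists v; split=> //.
  have -> : of_lattice R v = g%:~R^-1 *: a.
    rewrite aE a'E; apply/rowP => j; rewrite !mxE rmorphM/= mulKf//.
    by rewrite intr_eq0 gt_eqF.
  apply: cone_hull_scale; last exact: cone_hull_mem.
  by rewrite invr_ge0 ler0z ltW.
split=> //.
have [t t0 rgE] := Sa' _ Srg.
rewrite rgE pairingZr pmulr_rlt0// lt_def t0 andbT.
apply: contra_neq rg0 => t00; apply/eqP; rewrite -(of_lattice_eq0) rgE t00.
by rewrite scale0r.
Qed.

End FanRays.

(** * The polytope of a support function *)

Section Polytope.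
Variables (R : realType) (n : nat).
Implicit Types (m x p q l : 'rV[R]_n) (psi : 'rV[R]_n -> R).
Implicit Types (Sigma : set (set 'rV[R]_n)) (sigma rho : set 'rV[R]_n).

(** The polytope constrains [m] at ray generators, while the vectors listed for a cone need not be
    such. If [m - q] were negative at one of them, [fan_ray_neg] would give a ray generator in the
    same cone where it is negative, against [Pm]. *)
Lemma polytope_support Sigma psi m x : complete_fan Sigma ->
  pl_function Sigma psi -> polytope Sigma psi m -> psi x <= pairing m x.
Proof.
move=> fan [_ psi_lin] Pm.
have : setT x by [].
rewrite -(fan_complete fan) => -[sigma sS sx].
have [[s sE] _] := fan_cone fan sS; subst sigma.
have [q psiE] := psi_lin _ sS.
rewrite psiE// -subr_ge0 -pairingNl -pairingDl.
have [neg|/hasPn pos] :=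
    boolP (has (fun a => pairing (m - q) (of_lattice R a) < 0) s).
  have [rho rho1 [srg]] := fan_ray_neg fan sS neg.
  rewrite ltNge pairingDl pairingNl subr_ge0 -psiE// => /negP; case.
  exact: Pm.
apply: cone_hull_pairing_ge0 sx => _ /mapP[a sa ->].
by rewrite leNgt pos.
Qed.

Lemma bounded_int_rV_finite N :
  finite_set [set u : 'rV[int]_n | forall k, `|u 0 k| <= N%:Z].
Proof.
pose f (v : {ffun 'I_n -> 'I_(N + N).+1}) : 'rV[int]_n :=
  \row_k ((v k)%:Z - N%:Z).
apply: (@sub_finite_set _ _ (f @` setT)); last first.
  exact/finite_image/finite_finset.
move=> u /= uN; exists [ffun k => inord (absz (u 0 k + N%:Z))] => //.
apply/rowP => k; rewrite mxE ffunE inordK.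
  rewrite gez0_abs ?addrK// -lerBlDr sub0r.
  by have := uN k; rewrite ler_norml => /andP[].
have := uN k; rewrite ler_norml => /andP[uN1 uN2].
rewrite ltnS -lez_nat gez0_abs; last by rewrite -lerBlDr sub0r.
by rewrite PoszD lerD2r.
Qed.

(** [polytope_support] at [delta_mx 0 k] and at its opposite bounds coordinate [k]; [M] bounds all
    coordinates at once. *)
Lemma lattice_points_finite Sigma psi : complete_fan Sigma ->
  pl_function Sigma psi -> finite_set (lattice_points Sigma psi).
Proof.
move=> fan psi_pl.
pose M := \sum_(k < n) (`|psi (delta_mx 0 k)| + `|psi (- delta_mx 0 k)|).
apply: sub_finite_set (bounded_int_rV_finite (Num.bound M)) => u Pu k.
have MN : M < (Num.bound M)%:R.
  by rewrite archi_boundP// sumr_ge0// => j _; rewrite addr_ge0.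
have leM : `|psi (delta_mx 0 k)| + `|psi (- delta_mx 0 k)| <= M.
  by rewrite /M (bigD1 k)//= lerDl sumr_ge0// => j _; rewrite addr_ge0.
rewrite -(ler_int R) intr_norm; apply: le_trans (ltW MN); apply: le_trans leM.
have := polytope_support (delta_mx 0 k) fan psi_pl Pu.
have := polytope_support (- delta_mx 0 k) fan psi_pl Pu.
rewrite pairingNr pairing_delta mxE lerNr => h1 h2.
rewrite ler_norml; apply/andP; split.
  apply: le_trans h2; rewrite lerNl; apply: le_trans (ler_norm _) _.
  by rewrite normrN lerDl.
apply: (le_trans h1); apply: le_trans (ler_norm _) _.
by rewrite normrN lerDr.
Qed.

Lemma slopeP Sigma psi sigma x : pl_function Sigma psi -> Sigma sigma ->
  sigma x -> psi x = pairing (slope psi sigma) x.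
Proof.
move=> [_ psi_lin] sS sx; have [q qE] := psi_lin _ sS.
by have := @xgetPex _ 0 [set m | forall x, sigma x -> psi x = pairing m x]
  (ex_intro _ q qE); exact.
Qed.

(** The kernel of [m1 - m2] is a subspace containing the cone, hence everything; it contains
    [m1 - m2] itself, which is then 0 by positive definiteness. *)
Lemma full_cone_pairing_inj sigma m1 m2 : cone_dim sigma n ->
  (forall x, sigma x -> pairing m1 x = pairing m2 x) -> m1 = m2.
Proof.
move=> [U [_ Umin dimU]] m12.
have UT : U = fullv.
  by apply/eqP; rewrite eqEdim subvf/= dimvf /dim/= dimU mul1n.
pose F := linfun (mulmxr (m1 - m2)^T : 'rV[R]_n -> 'rV[R]_1).
have kerE x : (x \in lker F) = (pairing (m1 - m2) x == 0).
  rewrite memv_ker lfunE /= pairingC pairingE; apply/eqP/eqP => [->|x0].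
    by rewrite mxE.
  by apply/matrixP => i j; rewrite !ord1 x0 mxE.
have : (U <= lker F)%VS.
  apply: Umin => x sx; rewrite kerE pairingDl pairingNl.
  by rewrite m12// subrr.
rewrite UT => /subvP ker; apply/subr0_eq/eqP/negPn/negP => /pairing_gt0.
by have := ker (m1 - m2) (memvf _); rewrite kerE => /eqP ->; rewrite ltxx.
Qed.

(** Both slopes are choices, so their comparison rests on uniqueness over a full-dimensional
    cone. *)
Lemma slopeZ Sigma phi sigma c : pl_function Sigma phi ->
  pl_function Sigma (fun x => c * phi x) -> cones Sigma n sigma ->
  slope (fun x => c * phi x) sigma = c *: slope phi sigma.
Proof.
move=> phi_pl cphi_pl [sS sn]; apply: (full_cone_pairing_inj sn) => x sx.
by rewrite pairingZl -(slopeP cphi_pl)// -(slopeP phi_pl).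
Qed.

Lemma polytope_min_attained Sigma phi (r : nat) x :
  pl_function Sigma phi -> strictly_concave Sigma phi ->
  integral_pl Sigma (fun x => r%:R * phi x) ->
  exists2 u, lattice_points Sigma (fun x => r%:R * phi x) u &
    r%:R * phi x = pairing (of_lattice R u) x.
Proof.
move=> phi_pl [phi_min _] [rphi_pl rphi_int].
have [_ [sigma sn phix]] := phi_min x.
have [u uE] := rphi_int _ sn.
(* Integrality concerns the slope of [r phi], concavity that of [phi]; [slopeZ] relates the two. *)
have uE' : of_lattice R u = r%:R *: slope phi sigma.
  by rewrite -uE; exact: slopeZ phi_pl rphi_pl sn.
exists u; last by rewrite uE' pairingZl -phix.
move=> rho _; rewrite uE' pairingZl ler_wpM2l//.
by have [phi_le _] := phi_min (of_lattice R (ray_gen rho)); exact: phi_le.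
Qed.

End Polytope.

(** * The wrapping function *)

Section IntegerPowers.
Variable K : numFieldType.

(** With [t ^ k / t] in place of the power [k - 1], dividing by [t ^ k] leaves the logarithmic
    derivative [k / t]. *)
Lemma is_diff_exprz (k : int) (t : K) : t != 0 ->
  is_diff t ((fun z => z ^ k) : K -> K) (fun h => k%:~R * (t ^ k / t) * h).
Proof.
move=> t0; have dX m : is_diff t ((fun z => z ^+ m.+1) : K -> K)
    (fun h => m.+1%:R * t ^+ m * h).
  have -> : ((fun z => z ^+ m.+1) : K -> K) = id ^+ m.+1.
    by apply/funext => z; rewrite exprfctE.
  exact: is_diffX.
case: k => [[|m]|m].
- rewrite (_ : (fun _ => _) = cst 1)//.
  apply: is_diff_eq; apply/funext => h /=.
  by rewrite mul0r mul0r.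
- apply: (is_diff_eq (dX m)); apply/funext => h.
  by rewrite -exprnP exprSr mulfK.
- have t0' : t ^+ m.+1 != 0 by rewrite expf_neq0.
  rewrite (_ : (fun z => z ^ Negz m) = (fun z => (z ^+ m.+1)^-1))//.
  have [dfm dE] := dX m.
  apply: DiffDef; first exact: differentiableV.
  rewrite diffV// dE; apply/funext => h /=.
  rewrite NegzE mulrNz -exprnN.
  change (- (t ^+ m.+1) ^- 2 * (m.+1%:R * t ^+ m * h) =
    - m.+1%:R * (t ^- m.+1 / t) * h).
  rewrite !(exprSr t m).
  have tm0 : t ^+ m != 0 by rewrite expf_neq0.
  by field; rewrite t0 tm0.
Qed.

Lemma is_diff_sum (V W : normedModType K) (I : Type) (r : seq I)
    (f df : I -> V -> W) x : (forall i, is_diff x (f i) (df i)) ->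
  is_diff x (\sum_(i <- r) f i) (\sum_(i <- r) df i).
Proof.
move=> fdf; elim/big_rec2 : _ => [|i g dg _ dgx]; first exact: is_diff_cst.
exact: is_diffD.
Qed.

Lemma is_diff_row_exprz n (u : 'rV[int]_n) (t : K) : t != 0 ->
  is_diff t ((fun z => \row_k z ^ u 0 k) : K -> 'rV[K]_n)
    (fun h => \row_k ((u 0 k)%:~R * (t ^ u 0 k / t) * h)).
Proof.
move=> t0.
pose f k := (fun z : K => z ^ u 0 k *: (delta_mx 0 k : 'rV[K]_n)).
pose df k := (fun h : K => ((u 0 k)%:~R * (t ^ u 0 k / t) * h) *:
  (delta_mx 0 k : 'rV[K]_n)).
have fdf k : is_diff t (f k) (df k).
  have [df' dE] := is_diff_exprz (u 0 k) t0.
  apply: DiffDef; first exact: differentiableZl.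
  by rewrite /f diffZl// dE.
have row_sum (g : 'I_n -> K -> K) : (fun z => \row_k g k z) =
    \sum_(k < n) (fun z : K => g k z *: (delta_mx 0 k : 'rV[K]_n)).
  apply/funext => z; rewrite fct_sumE; apply/rowP => k.
  rewrite mxE summxE (bigD1 k)//= big1 => [|j /negPf jk]; rewrite !mxE !eqxx.
    by rewrite mulr1 addr0.
  by rewrite eq_sym jk mulr0.
by rewrite !row_sum; exact: is_diff_sum.
Qed.

End IntegerPowers.

Definition int_pairing n (w u : 'rV[int]_n) : int := \sum_(k < n) w 0 k * u 0 k.

(** The Gibbs average of the energy [<w, u>] with Boltzmann factor [b]; [b] near 0 is low
    temperature. A general field serves both the complex form and the real limit. *)
Definition gibbs_mean (F : fieldType) n (L : set 'rV[int]_n) u (b : F) : F :=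
  (\sum_(w \in L) (int_pairing w u)%:~R * b ^ int_pairing w u) /
  (\sum_(w \in L) b ^ int_pairing w u).

Lemma norm_exprz (K : numFieldType) (x : K) (k : int) : `|x ^ k| = `|x| ^ k.
Proof. by case: k => k; rewrite ?NegzE ?exprnN ?normfV normrX. Qed.

Section Wrapping.
Variable R : realType.
Local Open Scope complex_scope.
Let C := (R[i] : numClosedFieldType).

Lemma of_lattice_pairing n (w u : 'rV[int]_n) :
  pairing (of_lattice R w) (of_lattice R u) = (int_pairing w u)%:~R.
Proof.
rewrite rmorph_sum; apply: eq_bigr => k _.
by rewrite !mxE rmorphM.
Qed.

(** On the one-parameter subgroup, [chi w] is the monomial [t ^ int_pairing w u]. *)
Lemma norm_chi_one_param n (w u : 'rV[int]_n) (t : C) : t != 0 ->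
  `|chi w (one_param u t)| ^+ 2 = (`|t| ^+ 2) ^ int_pairing w u.
Proof.
move=> t0; have nt : `|t| ^+ 2 \is a GRing.unit.
  by rewrite unitfE expf_neq0// normr_eq0.
rewrite /chi normr_prod -prodrXl /int_pairing.
rewrite (big_morph (fun k => (`|t| ^+ 2) ^ k) (fun x y => exprzDr nt x y)
  (expr0z _)).
apply: eq_bigr => k _; rewrite mxE norm_exprz -exprz_exp !norm_exprz.
by rewrite !exprnP !exprz_exp; congr (_ ^ _); ring.
Qed.

(** ['i * t] is the velocity of the circle at [t]. There [dz_k / z_k] takes the value ['i * u_k] and
    its conjugate the opposite value; the factor [2 * 'i] of their difference cancels
    [- ('i / 2)]. *)
Lemma pullback_theta n Sigma psi (u : 'rV[int]_n) (t : C) :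
  finite_set (lattice_points Sigma psi) -> t != 0 ->
  pullback (@one_param R n u) (theta Sigma psi) t ('i * t) =
  gibbs_mean (lattice_points Sigma psi) u (`|t| ^+ 2).
Proof.
move=> Lfin t0; rewrite /pullback /theta /gibbs_mean.
set L := lattice_points Sigma psi.
have [_ dE] := is_diff_row_exprz u t0.
have zk k : (one_param u t) 0 k != 0 by rewrite mxE expfz_neq0.
rewrite [X in - _ * X](_ : _ = 2 * 'i * \sum_(k < n) (u 0 k)%:~R *
  ((\sum_(w \in L) (w 0 k)%:~R * (`|t| ^+ 2) ^ int_pairing w u) /
   \sum_(w \in L) (`|t| ^+ 2) ^ int_pairing w u)); last first.
  rewrite mulr_sumr; apply: eq_bigr => k _.
  have logdiff : ('d (@one_param R n u) t ('i * t)) 0 k / one_param u t 0 k =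
      'i * (u 0 k)%:~R.
    rewrite dE !mxE; have := zk k; rewrite mxE.
    by move: (t ^ u 0 k) => y y0; field; rewrite y0 t0.
  have conj_logdiff : (('d (@one_param R n u) t ('i * t)) 0 k)^* /
      (one_param u t 0 k)^* = - ('i * (u 0 k)%:~R).
    rewrite -fmorph_div logdiff rmorphM rmorph_int -mulNr; congr (_ * _).
    by apply/eqP; rewrite eq_complex /= oppr0 !eqxx.
  rewrite logdiff conj_logdiff opprK.
  under eq_fsbigr do rewrite norm_chi_one_param//.
  under [X in _ / X]eq_fsbigr do rewrite norm_chi_one_param//.
  by set q := _ / _; ring.
have -> (x : C) : - ('i / 2) * (2 * 'i * x) = x.
  rewrite mulrA (_ : - ('i / 2) * (2 * 'i) = 1) ?mul1r//.
  rewrite mulrA mulNr divfK ?pnatr_eq0// mulNr -expr2 sqr_i opprK//.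
under eq_bigr do rewrite mulrA.
rewrite -mulr_suml; congr (_ / _).
under eq_bigr do rewrite fsbig_finite// mulr_sumr.
rewrite exchange_big/= fsbig_finite//; apply: eq_bigr => w _.
rewrite /int_pairing rmorph_sum mulr_suml; apply: eq_bigr => k _.
by rewrite rmorphM mulrCA mulrA.
Qed.

Lemma velocity_circle (a s : R) : velocity (circle a) s = 'i * circle a s.
Proof.
rewrite /velocity /circle /=.
have dcos : is_derive s 1 (fun x => a * cos x) (a * - sin s).
  exact: (is_deriveZ a (is_derive_cos s)).
have dsin : is_derive s 1 (fun x => a * sin x) (a * cos s).
  exact: (is_deriveZ a (is_derive_sin s)).
rewrite !derive1E !derive_val; apply/eqP; rewrite eq_complex /=.
by apply/andP; split; apply/eqP; ring.
Qed.

Lemma norm_circle (a s : R) : 0 <= a -> `|circle a s : C| = a%:C.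
Proof.
move=> a0; rewrite normc_def /= !exprMn -mulrDr cos2Dsin2 mulr1.
by rewrite sqrtr_sqr ger0_norm.
Qed.

Lemma gibbs_mean_real n (L : set 'rV[int]_n) u (b : R) : finite_set L ->
  gibbs_mean L u (b%:C : C) = (gibbs_mean L u b)%:C.
Proof.
move=> Lfin; rewrite /gibbs_mean !fsbig_finite//.
rewrite fmorph_div !rmorph_sum.
congr (_ / _); apply: eq_bigr => w _; rewrite ?rmorphM ?rmorph_int fmorphXz//.
Qed.

(** The integrand depends on [t] through its modulus only, so on the circle it is a real constant,
    integrated over an interval of length [2 * pi]. *)
Lemma wrappingE n Sigma (rho : set 'rV[R]_n) psi (a : R) :
  finite_set (lattice_points Sigma psi) -> 0 < a ->
  wrapping Sigma rho psi a =
  (2 * pi * gibbs_mean (lattice_points Sigma psi) (ray_gen rho) (a ^+ 2))%:C.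
Proof.
move=> Lfin a0; rewrite /wrapping /circle_integral.
set q := gibbs_mean _ _ _.
under [X in integralC _ X]eq_fun => s.
  rewrite velocity_circle pullback_theta//; last first.
    by rewrite -normr_eq0 norm_circle ?ltW// (inj_eq (@complexI _)) gt_eqF.
  rewrite norm_circle ?ltW// -rmorphXn gibbs_mean_real//.
  over.
rewrite /integralC /=.
rewrite !Rintegral_cst//= lebesgue_measure_itv/= lte_fin.
rewrite mulr_gt0 ?pi_gt0//=.
by rewrite oppr0 addr0 mul0r mulrC.
Qed.

End Wrapping.

(** * The limit at zero *)

Section Limit.
Variable R : realType.
Local Open Scope complex_scope.
Let C := (R[i] : numClosedFieldType).

(** The error is the weighted mean of the gaps [d w - d w0]. Gaps are integers, so a nonzero one
    makes the weight at most [b * b ^ d w0], while the denominator is at least [b ^ d w0]. *)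
Lemma gibbs_mean_seq_dist (T : eqType) (r : seq T) (d : T -> int) w0 (b : R) :
  w0 \in r -> {in r, forall w, d w0 <= d w} -> 0 < b <= 1 ->
  `|(d w0)%:~R -
    (\sum_(w <- r) (d w)%:~R * b ^ d w) / (\sum_(w <- r) b ^ d w)| <=
  b * \sum_(w <- r) (d w - d w0)%:~R.
Proof.
move=> rw0 w0_min /andP[b0 b1].
have b_ge0 w : 0 <= b ^ d w by rewrite exprz_ge0// ltW.
have Z_ge : b ^ d w0 <= \sum_(w <- r) b ^ d w.
  rewrite (big_rem w0)//=.
  by rewrite lerDl sumr_ge0.
have Z_gt0 : 0 < \sum_(w <- r) b ^ d w.
  by rewrite (lt_le_trans _ Z_ge)// exprz_gt0.
have d_ge w : w \in r -> 0 <= d w - d w0 by move=> /w0_min; rewrite subr_ge0.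
have -> : (\sum_(w <- r) (d w)%:~R * b ^ d w) / (\sum_(w <- r) b ^ d w) =
    (d w0)%:~R + (\sum_(w <- r) (d w - d w0)%:~R * b ^ d w) /
    (\sum_(w <- r) b ^ d w).
  have -> : \sum_(w <- r) (d w - d w0)%:~R * b ^ d w =
      \sum_(w <- r) (d w)%:~R * b ^ d w - (d w0)%:~R * \sum_(w <- r) b ^ d w.
    rewrite mulr_sumr -sumrB; apply: eq_bigr => w _.
    by rewrite rmorphB mulrBl.
  by rewrite mulrBl mulfK ?gt_eqF// addrC subrK.
rewrite opprD addNKr normrN ger0_norm; last first.
  rewrite divr_ge0 ?(ltW Z_gt0)// big_seq sumr_ge0// => w wr.
  by rewrite mulr_ge0// ler0z d_ge.
rewrite ler_pdivrMr//.
apply: (@le_trans _ _ (b * (\sum_(w <- r) (d w - d w0)%:~R) * b ^ d w0));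
    last first.
  rewrite ler_wpM2l// mulr_ge0 ?(ltW b0)// big_seq sumr_ge0// => w wr.
  by rewrite ler0z d_ge.
rewrite mulr_sumr mulr_suml big_seq [leRHS]big_seq ler_sum// => w wr.
(* A zero gap contributes nothing; for a gap [m.+1], one factor [b] is kept and [b ^+ m] is bounded
   by 1. *)
have := d_ge _ wr; case E : (d w - d w0) => [[|m]|]// _.
  by rewrite mulr0 !mul0r.
have -> : d w = d w0 + Posz m.+1 by rewrite -E addrC subrK.
rewrite exprzDr ?unitfE ?gt_eqF//.
rewrite [leRHS](_ : _ = m.+1%:~R * (b ^ d w0 * b)); last by ring.
rewrite ler_wpM2l ?ler0z// ler_wpM2l// -exprnP exprS.
by rewrite ler_piMr ?exprn_ile1 ?(ltW b0).
Qed.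

Lemma gibbs_mean_dist n (L : set 'rV[int]_n) u w0 (b : R) :
  finite_set L -> L w0 ->
  (forall w, L w -> int_pairing w0 u <= int_pairing w u) -> 0 < b <= 1 ->
  `|((int_pairing w0 u)%:~R : R) - gibbs_mean L u b| <=
  b * \sum_(w \in L) ((int_pairing w u - int_pairing w0 u)%:~R : R).
Proof.
move=> Lfin Lw0 w0_min b01; rewrite /gibbs_mean !fsbig_finite//.
apply: (gibbs_mean_seq_dist (d := fun w => int_pairing w u)) => // [|w].
  by have := in_fset_set Lfin w0; rewrite (mem_set Lw0).
by have := in_fset_set Lfin w; rewrite /= => ->; rewrite inE; exact: w0_min.
Qed.

Lemma cvg_real_complex (T : Type) (F : set_system T) {FF : Filter F}
    (f : T -> R) (l : R) :
  f x @[x --> F] --> l -> ((f x)%:C : C) @[x --> F] --> (l%:C : C).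
Proof.
move=> /cvgrPdist_lt fl; apply/cvgrPdist_lt => e e0.
(* Positive elements of [R[i]] are real, so [e] is a real tolerance. *)
have eE : e = (complex.Re e)%:C by rewrite RRe_real// gtr0_real.
have Re0 : 0 < complex.Re e by rewrite -ltcR -eE.
apply: filterS (fl _ Re0) => x xl.
by rewrite -rmorphB normc_def /= expr0n addr0 sqrtr_sqr eE ltcR.
Qed.

End Limit.

(** By [gibbs_mean_dist] the error is at most [a ^+ 2 * D] for [0 < a < 1]. *)
Lemma gibbs_mean_cvg (R : realType) n (L : set 'rV[int]_n) u w0 :
  finite_set L -> L w0 ->
  (forall w, L w -> int_pairing w0 u <= int_pairing w u) ->
  gibbs_mean L u (a ^+ 2) @[a --> 0^'+] --> ((int_pairing w0 u)%:~R : R).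
Proof.
move=> Lfin Lw0 w0_min.
pose D : R := \sum_(w \in L) ((int_pairing w u - int_pairing w0 u)%:~R : R).
have sq0 : (a ^+ 2 * D) @[a --> (0 : R)^'+] --> (0 : R).
  rewrite -[X in _ --> X](mul0r D); apply: cvgMr_tmp.
  apply: cvg_at_right_filter; rewrite -[X in _ --> X](expr0n R 2).
  exact: exprn_continuous.
apply/cvgrPdist_le => e e0.
have /cvgrPdist_le/(_ _ e0) := sq0.
apply: filter_app; near=> a; rewrite sub0r normrN => /(le_trans (ler_norm _)).
apply: le_trans; apply: gibbs_mean_dist => //.
have a0 : 0 < a by near: a; exact: nbhs_right_gt.
by rewrite exprn_gt0// exprn_ile1 ?ltW//; near: a; exact: nbhs_right_lt.
Unshelve. all: by end_near. Qed.

Theorem corollary6p7 (R : realType) (n : nat) (n_ge1 : (1 <= n)%N)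
    (Sigma : set (set 'rV[R]_n)) (fanSigma : complete_fan Sigma)
    (phi : 'rV[R]_n -> R) (phi_rat : rational_pl Sigma phi)
    (phi_conc : strictly_concave Sigma phi)
    (r : nat) (r_gt0 : (0 < r)%N)
    (rphi_int : integral_pl Sigma (fun x => r%:R * phi x))
    (rho : set 'rV[R]_n) (rho_ray : cones Sigma 1 rho) :
  wrapping Sigma rho (fun x => r%:R * phi x) a @[a --> 0^'+] -->
    (((2 * pi * (r%:R * phi (of_lattice R (ray_gen rho))))%:C)%C :
       (R[i] : numClosedFieldType)).
Proof.
set u := ray_gen rho; pose L := lattice_points Sigma (fun x => r%:R * phi x).
have Lfin : finite_set L := lattice_points_finite fanSigma rphi_int.1.
have [w0 Lw0 phiu] :=
  polytope_min_attained (of_lattice R u) phi_rat.1 phi_conc rphi_int.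
have w0_min w : L w -> int_pairing w0 u <= int_pairing w u.
  move=> /(_ _ rho_ray); rewrite -/u phiu !of_lattice_pairing.
  by rewrite ler_int.
(* The closed formula holds for [a > 0], which is all that a right limit at 0 sees. *)
have wE : {near (0 : R)^'+, (fun a =>
    (2 * pi * gibbs_mean L u (a ^+ 2))%:C%C : R[i]) =1
    wrapping Sigma rho (fun x => r%:R * phi x)}.
  by near=> a; rewrite wrappingE.
apply: cvg_trans (near_eq_cvg wE) _.
rewrite phiu of_lattice_pairing.
by apply: cvg_real_complex; apply: cvgMl_tmp; exact: gibbs_mean_cvg.
Unshelve. all: by end_near. Qed.
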